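(* Let $R$ be a commutative ring with nonzero identity, $I$ an ideal of $R$, $M$ a unitary $R$-module and $P$ a proper submodule of $M$. Then the following are equivalent: (1) $P$ is an $I$-primary submodule of $M$. (2) For every $r \in R \setminus \sqrt{(P:M)}$, $(P:r) = P \cup (IP:r)$. (3) For every $r \in R \setminus \sqrt{(P:M)}$, $(P:r)=P$ or $(P:r)=(IP:r)$.
   Context: For a submodule $P$ of $M$: $(P:M)=\{r\in R : rM\subseteq P\}$, and for $r\in R$, $(P:r)=\{m\in M : rm\in P\}$ (likewise $(IP:r)=\{m\in M: rm\in IP\}$). For an ideal $A$ of $R$, $\sqrt{A}=\{a\in R : a^n\in A \text{ for some positive integer } n\}$. A proper submodule $P$ of $M$ is called an $I$-primary submodule of $M$ if for all $r\in R$ and $m\in M$, $rm\in P\setminus IP$ implies $m\in P$ or $r\in\sqrt{(P:M)}$. *)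

(* Defs.v *)
From mathcomp Require Import all_boot all_order all_algebra.
From mathcomp Require Import boolp classical_sets.
Set Implicit Arguments.
Unset Strict Implicit.
Unset Printing Implicit Defensive.
Import GRing.Theory.
Local Open Scope classical_set_scope.
Local Open Scope ring_scope.

(* Submodules and ideals are Prop-valued sets, so that no decidability of     *)
(* membership is required.                                                    *)
Definition is_submodule (R : comNzRingType) (M : lmodType R) (P : set M) : Prop :=
  GRing.submod_closed (mem P).

(* MathComp's idealr_closed only covers proper ideals; here I = R is allowed. *)
Definition is_ideal (R : comNzRingType) (I : set R) : Prop :=
  @is_submodule R R^o I.

(* The submodule IP, generated by the products a *: p: finite sums of them.   *)
Definition ideal_mul (R : comNzRingType) (M : lmodType R)
    (I : set R) (P : set M) : set M :=
  [set m | exists s : seq (R * M),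
     (forall x, x \in s -> I x.1 /\ P x.2) /\ m = \sum_(x <- s) x.1 *: x.2].

(* (P : M) *)
Definition colon_module (R : comNzRingType) (M : lmodType R) (P : set M) : set R :=
  [set r | forall m : M, P (r *: m)].

(* (P : r) *)
Definition colon_elt (R : comNzRingType) (M : lmodType R)
    (P : set M) (r : R) : set M :=
  [set m | P (r *: m)].

Definition radical (R : comNzRingType) (A : set R) : set R :=
  [set a | exists2 n : nat, (0 < n)%N & A (a ^+ n)].

Definition is_primary_submodule (R : comNzRingType) (M : lmodType R)
    (I : set R) (P : set M) : Prop :=
  [/\ is_submodule P, P <> setT &
      forall (r : R) (m : M), (P `\` ideal_mul I P) (r *: m) ->
        P m \/ radical (colon_module P) r].

(* Main.v *)
Require Import Defs.
From mathcomp Require Import all_boot all_order all_algebra.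
From mathcomp Require Import boolp classical_sets.
Import GRing.Theory.
Local Open Scope classical_set_scope.
Local Open Scope ring_scope.

(** For [r] outside the radical of [(P:M)], being primary says that [rm] in [P] forces [m] in [P] or
    [rm] in [IP], that is, [(P:r)] lies in the union of [P] and [(IP:r)]. The reverse inclusion
    holds because [P] is stable under [r] and [IP] lies in [P] ([ideal_mul_sub]). All three sets are
    submodules, and a submodule that is the union of two submodules equals one of them
    ([submodule_eq_setU]); this gives the dichotomy. Conversely, either equality of the dichotomy
    settles an [m] with [rm] in [P] but not in [IP]. *)

Lemma submodule0 (R : comNzRingType) (M : lmodType R) (P : set M) :
  is_submodule P -> P 0.
Proof. by case=> /set_mem. Qed.

Lemma submoduleZD (R : comNzRingType) (M : lmodType R) (P : set M)
    (a : R) (u v : M) :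
  is_submodule P -> P u -> P v -> P (a *: u + v).
Proof. by case=> _ PZD Pu Pv; apply/set_mem/PZD; apply/mem_set. Qed.

Lemma submoduleZ (R : comNzRingType) (M : lmodType R) (P : set M)
    (a : R) (u : M) : is_submodule P -> P u -> P (a *: u).
Proof.
move=> hP Pu; rewrite -[_ *: _]addr0; apply: submoduleZD => //.
exact: submodule0.
Qed.

Lemma submoduleB (R : comNzRingType) (M : lmodType R) (P : set M) (u v : M) :
  is_submodule P -> P u -> P v -> P (u - v).
Proof. by move=> hP Pu Pv; rewrite addrC -scaleN1r; apply: submoduleZD. Qed.

Lemma ideal_mul_sub (R : comNzRingType) (M : lmodType R)
    (I : set R) (P : set M) :
  is_submodule P -> ideal_mul I P `<=` P.
Proof.
move=> hP _ [s [hs ->]]; elim: s hs => [|x s IHs] hs.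
  by rewrite big_nil; apply: submodule0.
rewrite big_cons; apply: submoduleZD => //.
  by case: (hs x); rewrite ?mem_head.
by apply: IHs => y ys; apply: hs; rewrite inE ys orbT.
Qed.

Lemma ideal_mul_submodule (R : comNzRingType) (M : lmodType R)
    (I : set R) (P : set M) :
  is_submodule P -> is_submodule (ideal_mul I P).
Proof.
move=> hP; split=> [|a _ _ /set_mem[s [hs ->]] /set_mem[t [ht ->]]].
  by apply/mem_set; exists [::]; rewrite big_nil.
(* The scalar is moved onto the factor in [P], as [a(ip) = i(ap)] by commutativity; concatenation
   adds the two sums. *)
apply/mem_set; exists ([seq (x.1, a *: x.2) | x <- s] ++ t); split=> [x|].
  rewrite mem_cat => /orP[/mapP[y /hs[Iy Py] ->]|/ht//].
  by split=> //=; apply: submoduleZ.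
rewrite big_cat big_map scaler_sumr /=; congr (_ + _).
by apply: eq_bigr => x _; rewrite !scalerA mulrC.
Qed.

(** This is the preimage of [P] under multiplication by [r], which is linear because [R] is
    commutative. *)
Lemma colon_elt_submodule (R : comNzRingType) (M : lmodType R)
    (P : set M) (r : R) :
  is_submodule P -> is_submodule (colon_elt P r).
Proof.
move=> hP; split=> [|a u v /set_mem Pu /set_mem Pv]; apply/mem_set.
  by rewrite /colon_elt /= scaler0; apply: submodule0.
rewrite /colon_elt /= scalerDr scalerA mulrC -scalerA.
exact: submoduleZD.
Qed.

Lemma submodule_eq_setU (R : comNzRingType) (M : lmodType R)
    (N A B : set M) :
  is_submodule N -> is_submodule A -> is_submodule B ->
  N = A `|` B -> N = A \/ N = B.
Proof.
move=> hN hA hB defN.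
have [AB|/existsNP[x /not_implyP[Ax nBx]]] := pselect (A `<=` B).
  by right; rewrite defN; apply/setUidPr.
left; rewrite defN; apply/setUidPl => y By.
(* With [x] in [A] but not in [B] and [y] in [B], the difference [x - y] cannot lie in [B], or [x]
   would; so it lies in [A], and hence so does [y]. *)
have : N (x - y) by apply: submoduleB => //; rewrite defN; [left | right].
rewrite defN => -[Axy|Bxy].
  by rewrite -[y](subKr x); apply: submoduleB.
case: nBx; rewrite -[x](subrK y) -[x - y]scale1r.
exact: submoduleZD.
Qed.

Theorem theorem2p4 (R : comNzRingType) (I : set R) (M : lmodType R) (P : set M)
    (hI : is_ideal I) (hP : is_submodule P) (hPproper : P <> setT) :
  [<-> is_primary_submodule I P;
       forall r : R, ~ radical (colon_module P) r ->
         colon_elt P r = P `|` colon_elt (ideal_mul I P) r;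
       forall r : R, ~ radical (colon_module P) r ->
         colon_elt P r = P \/ colon_elt P r = colon_elt (ideal_mul I P) r].
Proof.
tfae.
- move=> [_ _ primP] r nr; apply/seteqP; split=> m /=.
    move=> Prm; have [IPrm|nIPrm] := pselect (ideal_mul I P (r *: m)).
      by right.
    by left; case: (primP r m).
  by case=> [Pm|IPrm]; [apply: submoduleZ | apply: ideal_mul_sub IPrm].
- move=> cover r /cover; apply: submodule_eq_setU => //.
    exact: colon_elt_submodule.
  exact/colon_elt_submodule/ideal_mul_submodule.
- move=> dich; split=> // r m [Prm nIPrm].
  have [|/dich[eqP|eqIP]] := pselect (radical (colon_module P) r).
  + by right.
  + by left; rewrite -eqP.
  (* Here [m] in [(P:r) = (IP:r)] would put [rm] in [IP], which is excluded. *)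
  + by case: nIPrm; have : colon_elt P r m by []; rewrite eqIP.
Qed.
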